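(* Fix integers $r \ge 2$ and $K \geq 1$. Let $\{H_n\}_{n\ge 1}$ be a sequence of $r$-uniform hypergraphs in which each hyperedge $e\in E(H_n)$ carries an integer weight $w_e\in\{1,\dots,K\}$, with vertices colored uniformly at random with $c_n$ colors, where $c_n\to\infty$. Suppose $$\lim_{n \to \infty}\mathbb{E}\, \mathsf{W}(H_n) = \lambda \quad\text{and}\quad \lim_{n \to \infty}\mathrm{Var}\, \mathsf{W}(H_n) = \lambda$$ for some $\lambda \ge 0$. Then, as $n \to \infty$, $\mathsf{W}(H_n)$ converges in distribution to $\mathrm{Pois}(\lambda)$.
   Context: An $r$-uniform hypergraph $H=(V(H),E(H))$ consists of a finite vertex set $V(H)$ and a set $E(H)$ of $r$-element subsets of $V(H)$, called hyperedges. ''Colored uniformly at random with $c_n$ colors'' means each vertex $v$ gets a color $X_v$ uniform on $\{1,\dots,c_n\}$, independently over the vertices. $\mathsf W(H_n)=\sum_{e\in E(H_n)}w_e\,\mathbf 1\{X_v=X_{v'}\ \forall v,v'\in e\}$ is the weighted count of monochromatic hyperedges. $\mathrm{Pois}(0)$ is the point mass at $0$. *)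

(* Defs.v *)
From HB Require Import structures.
From mathcomp Require Import all_boot all_order all_algebra.
From mathcomp Require Import all_classical all_reals all_analysis.
From mathcomp Require Import measurable_realfun.

Set Implicit Arguments.
Unset Strict Implicit.
Unset Printing Implicit Defensive.

Import Order.TTheory GRing.Theory Num.Theory.
Import numFieldNormedType.Exports.

Local Open Scope classical_set_scope.
Local Open Scope ring_scope.

Record hypergraph (r : nat) := Hypergraph {
  vertex :> finType;
  hyperedges : {set {set vertex}};
  card_hyperedge : forall e, e \in hyperedges -> #|e| = r }.

(* The events [A i] may be the full set, so this product formula over all of
   [I] contains the one over every subfamily of [I]. *)
Definition mutually_independent d d' (T : measurableType d)
    (T' : measurableType d') (R : realType) (P : probability T R)
    (I : finType) (X : I -> {RV P >-> T'}) : Prop :=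
  forall A : I -> set T', (forall i, measurable (A i)) ->
    P (\bigcap_i (X i @^-1` A i)) = (\prod_(i : I) P (X i @^-1` A i))%E.

(* The colors are the natural numbers 1, ..., c. *)
Definition uniform_coloring d (T : measurableType d) (R : realType)
    (P : probability T R) (V : finType) (c : nat) (X : V -> {RV P >-> nat})
    : Prop :=
  mutually_independent X /\
  forall v k, (1 <= k <= c)%N -> P (X v @^-1` [set k]) = (c%:R^-1)%:E.

Section weighted_count.
Context d (T : measurableType d) (R : realType) (P : probability T R).
Context (r : nat) (H : hypergraph r) (w : {set H} -> nat).
Context (X : H -> {RV P >-> nat}).

Definition monochromatic (e : {set H}) : set T :=
  [set t | forall v v', v \in e -> v' \in e -> X v t = X v' t].

Definition weighted_count (t : T) : R :=
  \sum_(e in hyperedges H) (w e)%:R * \1_(monochromatic e) t.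

Lemma measurable_monochromatic e : measurable (monochromatic e).
Proof.
have -> : monochromatic e = \bigcap_(v in [set` e]) \bigcap_(v' in [set` e])
    \bigcup_k (X v @^-1` [set k] `&` X v' @^-1` [set k]).
  apply/seteqP; split => t /= h.
    by move=> v ve v' v'e; exists (X v t) => //; split => //=; rewrite (h v v').
  by move=> v v' ve v'e; have [k _ [/= -> ->]] := h v ve v' v'e.
apply: fin_bigcap_measurable => // v _.
apply: fin_bigcap_measurable => // v' _.
apply: bigcup_measurable => k _.
by apply: measurableI; exact: measurable_funPTI.
Qed.

Lemma measurable_weighted_count : measurable_fun setT weighted_count.
Proof.
rewrite /weighted_count; under eq_fun do rewrite -big_enum.
apply: measurable_sum => e.
apply: measurable_funM => //.
exact/measurable_indic/measurable_monochromatic.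
Qed.

HB.instance Definition _ :=
  isMeasurableFun.Build _ _ _ _ weighted_count measurable_weighted_count.

End weighted_count.

Section poisson_law.
Context (R : realType).

Definition nat_to_real (k : nat) : R := k%:R.

Lemma measurable_nat_to_real : measurable_fun setT nat_to_real.
Proof. by []. Qed.

HB.instance Definition _ :=
  isMeasurableFun.Build _ _ _ _ nat_to_real measurable_nat_to_real.

(* [poisson_prob] is a law on [nat], equal to the Dirac mass at 0 for the rate
   0; its second argument is a dummy which does not occur in its body. *)
Definition poisson_law (rate : R) : probability R R :=
  distribution (poisson_prob rate 0) nat_to_real.

End poisson_law.

(* Each [X n] may live on its own probability space. *)
Definition cvg_in_distribution (R : realType) (d : nat -> measure_display)
    (T : forall n, measurableType (d n)) (P : forall n, probability (T n) R)
    (X : forall n, {RV (P n) >-> R}) (mu : probability R R) : Prop :=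
  forall x : R, {for x, continuous (fun y : R => mu `]-oo, y]%classic)} ->
    cdf (X n) x @[n --> \oo] --> mu `]-oo, x]%classic.

(* Main.v *)
Require Import Defs.
From HB Require Import structures.
From mathcomp Require Import all_boot all_order all_algebra.
From mathcomp Require Import ring lra zify.

(** Write [W] for the weighted count, [N] for the number of monochromatic
    hyperedges and [p = c^(1-r)] for the probability that a given hyperedge is
    monochromatic.

    The indicators of two hyperedges sharing at most one vertex are
    uncorrelated; if they share at least two, their covariance is at least half of
    the probability that both are monochromatic, as soon as [c >= 2]. A hyperedge of
    weight [w] contributes about [w * (w - 1) * p] to the difference of variance
    and mean. As variance and mean have the same limit, all these nonnegative
    contributions vanish ([variance_excess]): overlapping pairs of hyperedges and
    hyperedges of weight at least 2 are negligible. In particular [W = N] with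
    probability tending to 1, so it is enough to treat [N].

    [N] is handled by Stein's method with an explicit size-biased coupling.
    Conditioning the uniform coloring on a hyperedge [e] being monochromatic
    amounts to giving all of [e] the color of one of its vertices [u]
    ([avg_mono]). This raises [N] by exactly one unless another hyperedge meeting
    [e] outside of [u] interferes. Hyperedges overlapping [e] in two vertices are
    negligible by the above. Those meeting [e] in one vertex need not be few: all
    hyperedges may share a vertex. But when [u] is chosen of maximal degree in
    [e], the number of interfering pairs is at most the sum, over pairs of
    vertices, of the codegree times the smaller degree, and the sum of the squared
    codegrees is again controlled by the overlapping pairs ([sum_minn_deg]).
    Therefore [(k + 1) * P(N = k + 1) - E[N] * P(N = k)] tends to 0 for each [k]
    ([stein_bound]).

    In the limit this is the recursion that determines the Poisson weights up to a
    factor, and Markov's inequality shows that the total mass is 1 ([pmf_cvg]). *)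

Set Implicit Arguments.
Unset Strict Implicit.
Unset Printing Implicit Defensive.
Import Order.TTheory GRing.Theory Num.Theory.
Local Open Scope ring_scope.

(** * Uniform colorings and recoloring *)

Section average.
Context (R : realFieldType) (T : finType).
Implicit Types F G : T -> R.

Definition avg F : R := (\sum_x F x) / #|T|%:R.

Lemma eq_avg F G : F =1 G -> avg F = avg G.
Proof. by move=> FG; rewrite /avg (eq_bigr _ (fun x _ => FG x)). Qed.

Lemma avgD F G : avg (fun x => F x + G x) = avg F + avg G.
Proof. by rewrite /avg big_split mulrDl. Qed.

Lemma avgZ a F : avg (fun x => a * F x) = a * avg F.
Proof. by rewrite /avg -mulr_sumr mulrA. Qed.

Lemma avgB F G : avg (fun x => F x - G x) = avg F - avg G.
Proof. by rewrite /avg sumrB mulrBl. Qed.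

Lemma avg_sum (I : finType) (A : pred I) (F : I -> T -> R) :
  avg (fun x => \sum_(i | A i) F i x) = \sum_(i | A i) avg (F i).
Proof. by rewrite /avg exchange_big mulr_suml. Qed.

Lemma le_avg F G : (forall x, F x <= G x) -> avg F <= avg G.
Proof. by move=> FG; rewrite ler_wpM2r ?invr_ge0 ?ler0n// ler_sum. Qed.

Lemma avg_ge0 F : (forall x, 0 <= F x) -> 0 <= avg F.
Proof. by move=> F0; rewrite divr_ge0 ?ler0n// sumr_ge0. Qed.

Lemma avg_norm F : `|avg F| <= avg (fun x => `|F x|).
Proof.
rewrite /avg normrM [`|_^-1|]ger0_norm ?invr_ge0 ?ler0n//.
by rewrite ler_wpM2r ?invr_ge0 ?ler0n ?ler_norm_sum.
Qed.

Lemma avg_cst a : (0 < #|T|)%N -> avg (fun=> a) = a.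
Proof.
by move=> T0; rewrite /avg sumr_const -[a *+ _]mulr_natr mulfK// pnatr_eq0 -lt0n.
Qed.

End average.

Section monochromatic.
Context (V : finType) (C : eqType).
Implicit Types (f : V -> C) (e : {set V}).

Definition mono f e : bool := [forall u in e, forall v in e, f u == f v].

Lemma monoP f e :
  reflect (forall u v, u \in e -> v \in e -> f u = f v) (mono f e).
Proof.
apply: (iffP forall_inP) => [fe u v ue ve|fe u ue].
  by apply/eqP; have /forall_inP := fe u ue; apply.
by apply/forall_inP => v ve; rewrite (fe u v).
Qed.

Lemma eq_mono_in f g e : {in e, f =1 g} -> mono f e = mono g e.
Proof.
move=> fg; apply/monoP/monoP => h u v ue ve.
  by rewrite -!fg// (h u v).
by rewrite !fg// (h u v).
Qed.

Lemma mono_setU f e e' u : u \in e -> u \in e' ->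
  mono f (e :|: e') = mono f e && mono f e'.
Proof.
move=> ue ue'; apply/monoP/andP => [h|[/monoP h /monoP h'] v v'].
  by split; apply/monoP => v v' ve ve'; apply: h; rewrite inE ?ve ?ve' ?orbT.
have hu x : x \in e :|: e' -> f x = f u.
  by rewrite inE => /orP[xe|xe]; [rewrite (h x u)|rewrite (h' x u)].
by move=> /hu -> /hu ->.
Qed.

End monochromatic.

Section recoloring.
Context (R : realFieldType) (V : finType) (c : nat) (c_gt0 : (0 < c)%N).
Local Notation coloring := {ffun V -> 'I_c}.
Implicit Types (x y : coloring) (e : {set V}) (G : coloring -> R).

Lemma card_coloring_gt0 : (0 < #|{: coloring}|)%N.
Proof. by rewrite card_ffun card_ord expn_gt0 c_gt0. Qed.

Definition recolor e u x : coloring := [ffun v => if v \in e then x u else x v].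

Lemma recolor_mono e u x : mono (recolor e u x) e.
Proof. by apply/monoP => v v' ve v'e; rewrite !ffunE ve v'e. Qed.

(** Recoloring changes only the vertices of [e] other than [u]. *)
Lemma recolor_mono_out e e' u x : u \in e -> [disjoint e' & e :\ u] ->
  mono (recolor e u x) e' = mono x e'.
Proof.
move=> ue dis; apply: eq_mono_in => v ve'; rewrite ffunE; case: ifPn => // ve.
by have := disjointFr dis ve'; rewrite !inE ve andbT => /negbFE/eqP ->.
Qed.

(** A preimage of [y] may take any color on [e] outside of [u] and agrees with
    [y] elsewhere. *)
Lemma card_recolor_fiber e u y : u \in e ->
  #|[pred x | recolor e u x == y]| = (mono y e * c ^ #|e|.-1)%N.
Proof.
move=> ue; have [ye|yNe] := boolP (mono y e); last first.
  apply: eq_card0 => x; rewrite inE; apply: contraNF yNe => /eqP <-.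
  exact: recolor_mono.
pose F v : pred 'I_c := if v \in e :\ u then predT else pred1 (y v).
have -> : #|[pred x | recolor e u x == y]| = #|family F|.
  apply: eq_card => x; rewrite inE; apply/eqP/familyP => [xy v|xF].
    rewrite /F -xy !inE; case: ifPn => //; rewrite negb_and negbK.
    rewrite inE ffunE; case: ifPn => [ve|//]; rewrite orbF => /eqP ->.
    by rewrite eqxx.
  apply/ffunP => v; rewrite ffunE; case: ifPn => ve; last first.
    by have := xF v; rewrite /F !inE (negbTE ve) andbF => /eqP.
  have := xF u; rewrite /F !inE eqxx => /eqP ->.
  by move/monoP: ye => /(_ u v ue ve).
rewrite card_family foldrE big_map big_enum/= mul1n.
rewrite (eq_bigr (fun v => if v \in e :\ u then c else 1%N)); last first.
  by move=> v _; rewrite /F; case: ifP => _; rewrite ?card1 ?card_ord.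
by rewrite -big_mkcond prod_nat_const (cardsD1 u e) ue.
Qed.

(** Recoloring sends the uniform coloring to the uniform coloring conditioned on
    [e] being monochromatic: by [card_recolor_fiber], all colorings that are
    monochromatic on [e] have the same number of preimages, and the others have
    none. This is the coupling behind both the joint probabilities and Stein's
    method below. *)
Lemma avg_mono e u G : u \in e ->
  avg (fun x => (mono x e)%:R * G x) =
  (c ^ #|e|.-1)%:R^-1 * avg (fun x => G (recolor e u x)).
Proof.
move=> ue; rewrite /avg mulrA; congr (_ / _).
rewrite [in RHS](partition_big (recolor e u) predT)//= mulr_sumr.
apply: eq_bigr => y _.
rewrite (eq_bigr (fun=> G y)); last by move=> x /eqP ->.
rewrite sumr_const card_recolor_fiber// mulrnA.
rewrite -(mulr_natl (G y *+ _)) mulKf.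
  by case: mono; rewrite ?mul1r ?mul0r.
by rewrite pnatr_eq0 expn_eq0; lia.
Qed.

Lemma avg_mono1 e u : u \in e ->
  avg (fun x : coloring => (mono x e)%:R) = (c ^ #|e|.-1)%:R^-1 :> R.
Proof.
move=> ue; have := @avg_mono e u (fun=> 1) ue.
rewrite (avg_cst _ card_coloring_gt0) mulr1 => <-.
by apply: eq_avg => x; rewrite mulr1.
Qed.

End recoloring.

(** * Degrees and codegrees *)

Section degrees.
Context (V : finType) (r : nat) (E : {set {set V}}).
Hypothesis E_unif : forall e, e \in E -> #|e| = r.
Local Open Scope nat_scope.

Definition deg v := \sum_(e in E) (v \in e).

Definition codeg u v := \sum_(e in E) ((u \in e) && (v \in e)).

(** Two hyperedges sharing a single vertex have independent indicators, so only
    pairs sharing at least two contribute to the variance. *)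
Definition overlaps (e e' : {set V}) : bool := (e' != e) && (1 < #|e :&: e'|).

Lemma sum_deg : \sum_v deg v = r * #|E|.
Proof.
rewrite exchange_big/= (eq_bigr (fun=> r)); first by rewrite sum_nat_const mulnC.
by move=> e /E_unif <-; rewrite -sum1_card [RHS]big_mkcond; apply: eq_bigr => v _; case: (v \in e).
Qed.

(** Take [u] of maximal degree in [e]: then each degree on the left is already
    the minimum in a pair with [u]. Enlarging the sum to all ordered pairs in [e]
    makes the bound independent of [u], and summing it over the hyperedges turns
    it into a sum of codegrees over pairs of vertices. *)
Lemma exists_hub (e : {set V}) : e != finset.set0 ->
  exists2 u, u \in e & \sum_(v in e :\ u) deg v <=
    \sum_(u in e) \sum_(v in e :\ u) minn (deg u) (deg v).
Proof.
case/set0Pn => u0 u0e.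
have [u ue umax] := @arg_maxnP _ u0 (mem e) deg u0e.
exists u => //; rewrite [leqRHS](bigD1 u)//=; apply: leq_trans (leq_addr _ _).
apply: leq_sum => v; rewrite inE => /andP[_ /umax].
by move=> /minn_idPr ->.
Qed.

(** Expanding the square counts, for each pair of hyperedges, equal or not, the
    ordered pairs of distinct vertices in their intersection. *)
Lemma sum_sqr_codeg : \sum_u \sum_(v | v != u) codeg u v ^ 2 <=
  r ^ 2 * (#|E| + \sum_(e in E) \sum_(e' in E | overlaps e e') 1).
Proof.
have -> : \sum_u \sum_(v | v != u) codeg u v ^ 2 =
    \sum_(e in E) \sum_(e' in E) \sum_(u in e :&: e')
      \sum_(v in (e :&: e') :\ u) 1.
  under eq_bigr => u _ do under eq_bigr => v _ do
    rewrite -mulnn big_distrlr/=.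
  under eq_bigr => u _ do rewrite exchange_big/=.
  rewrite exchange_big/=; apply: eq_bigr => e eE.
  under eq_bigr => u _ do rewrite exchange_big/=.
  rewrite exchange_big/=; apply: eq_bigr => e' e'E.
  rewrite [RHS]big_mkcond/=; apply: eq_bigr => u _.
  case: (boolP (u \in e :&: e')) => [|/negbTE]; rewrite inE => uee'.
    move/andP: uee' => [ue ue'].
    rewrite big_mkcond [RHS]big_mkcond/=; apply: eq_bigr => v _.
    rewrite !inE ue ue'/=.
    by case: eqVneq => //= _; case: (v \in e); case: (v \in e').
  apply: big1 => v _.
  by move: uee'; case: (u \in e); case: (u \in e') => //=; rewrite muln0.
have bnd (e e' : {set V}) : e \in E ->
    \sum_(u in e :&: e') \sum_(v in (e :&: e') :\ u) 1 <=
    r ^ 2 * (1 < #|e :&: e'|).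
  move=> /E_unif er.
  have tr : #|e :&: e'| <= r by rewrite -er subset_leq_card ?subsetIl.
  rewrite (eq_bigr (fun=> #|e :&: e'|.-1)); last first.
    by move=> u uI; rewrite sum1_card [in RHS](cardsD1 u) uI.
  rewrite sum_nat_const; case: (ltnP 1 #|_ :&: _|) => t1; last by nia.
  by rewrite muln1 -mulnn leq_mul//; lia.
rewrite mulnDr mulnC -sum_nat_const big_distrr -big_split/=.
apply: leq_sum => e eE; rewrite (bigD1 e)//= leq_add//.
  by apply: leq_trans (bnd _ _ eE) _; case: (1 < _); rewrite ?muln1 ?muln0.
rewrite big_distrr/= muln1 big_mkcond/= [leqRHS]big_mkcond/=.
apply: leq_sum => e' _; rewrite /overlaps andbA.
case: ifP => //= _; apply: leq_trans (bnd _ _ eE) _.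
by case: (1 < _); rewrite ?muln1 ?muln0.
Qed.

(** Grouped by pairs of vertices, the sum is that of [codeg * min]. By the
    arithmetic-geometric mean inequality [2 * (s * codeg) * min] is at most
    [(s * codeg)^2 + min^2], and the square of the minimum is at most the product
    of the two degrees, which sums to the square of the total degree. *)
Lemma sum_minn_deg s :
  2 * s * \sum_(e in E) \sum_(u in e) \sum_(v in e :\ u) minn (deg u) (deg v) <=
  s ^ 2 * (r ^ 2 * (#|E| + \sum_(e in E) \sum_(e' in E | overlaps e e') 1)) +
  (r * #|E|) ^ 2.
Proof.
have -> : \sum_(e in E) \sum_(u in e) \sum_(v in e :\ u) minn (deg u) (deg v) =
    \sum_u \sum_(v | v != u) codeg u v * minn (deg u) (deg v).
  under eq_bigr => e _ do rewrite big_mkcond/=.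
  rewrite exchange_big/=; apply: eq_bigr => u _.
  under [RHS]eq_bigr => v _ do rewrite big_distrl/=.
  rewrite [RHS]exchange_big/=; apply: eq_bigr => e _.
  case: ifPn => [ue|_]; last by rewrite big1.
  rewrite big_mkcond [RHS]big_mkcond/=; apply: eq_bigr => v _.
  by rewrite !inE; case: eqVneq => //= _; case: (v \in e); rewrite ?mul1n.
apply: leq_trans (leq_add (leq_mul (leqnn _) sum_sqr_codeg) (leqnn _)).
rewrite -sum_deg -(mulnn (\sum_v _)) [X in _ + X]big_distrlr/= !big_distrr/= -big_split/=.
apply: leq_sum => u _.
rewrite !big_distrr/=.
apply: (@leq_trans (\sum_(v | v != u) (s ^ 2 * codeg u v ^ 2 + deg u * deg v))).
  apply: leq_sum => v _.
  have [+ _] := nat_Cauchy (s * codeg u v) (minn (deg u) (deg v)).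
  have : minn (deg u) (deg v) ^ 2 <= deg u * deg v.
    by rewrite -mulnn leq_mul// ?geq_minl ?geq_minr.
  rewrite -expnMn.
  move=> min_le cauchy; rewrite -mulnA (mulnA s); apply: leq_trans cauchy _.
  by rewrite leq_add2l.
rewrite big_split/= leq_add2l [leqRHS](bigID (fun v => v != u))/=.
exact: leq_addr.
Qed.

End degrees.

(** * Joint probabilities and Stein's method *)

Section one_hypergraph.
Context (R : realFieldType) (V : finType) (c : nat) (c_gt0 : (0 < c)%N).
Context (r : nat) (r_ge2 : (2 <= r)%N) (E : {set {set V}}).
Hypothesis E_unif : forall e, e \in E -> #|e| = r.
Local Notation coloring := {ffun V -> 'I_c}.
Implicit Types (x : coloring) (e : {set V}).

Definition edge_prob : R := (c ^ r.-1)%:R^-1.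
Local Notation p := edge_prob.

Definition joint_prob e e' : R :=
  avg (fun x => (mono x e)%:R * (mono x e')%:R).

Lemma edge_prob_gt0 : 0 < p.
Proof. by rewrite invr_gt0 ltr0n expn_gt0 c_gt0. Qed.

Lemma edge_neq0 e : e \in E -> e != finset.set0.
Proof. by move=> /E_unif er; rewrite -card_gt0 er; lia. Qed.

Lemma avg_mono_edge e : e \in E -> avg (fun x => (mono x e)%:R) = p.
Proof.
move=> eE; have /set0Pn[u ue] := edge_neq0 eE.
by rewrite (avg_mono1 _ c_gt0 ue) E_unif.
Qed.

Lemma joint_prob_ge0 e e' : 0 <= joint_prob e e'.
Proof. by apply: avg_ge0 => x; rewrite mulr_ge0 ?ler0n. Qed.

Lemma joint_prob_recolor e e' u : e \in E -> u \in e ->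
  joint_prob e e' = p * avg (fun x => (mono (recolor e u x) e')%:R).
Proof. by move=> eE ue; rewrite /joint_prob (avg_mono c_gt0 _ ue) E_unif. Qed.

Lemma joint_prob_diag e : e \in E -> joint_prob e e = p.
Proof.
by move=> eE; rewrite -(avg_mono_edge eE); apply: eq_avg => x; rewrite -natrM mulnb andbb.
Qed.

(** If the hyperedges meet, recolor [e] with the color of the common vertex; this
    leaves [e'] unchanged. *)
Lemma joint_prob_small e e' : e \in E -> e' \in E -> (#|e :&: e'| <= 1)%N ->
  joint_prob e e' = p * p.
Proof.
move=> eE e'E ee'.
have [u ue dis] : exists2 u, u \in e & [disjoint e' & e :\ u].
  have [/eqP I0|/set0Pn[u uI]] := boolP (e :&: e' == finset.set0).
    have /set0Pn[u ue] := edge_neq0 eE; exists u => //.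
    by rewrite -setI_eq0 -subset0 -I0 setIC setSI ?subD1set.
  exists u; first by move: uI; rewrite inE => /andP[].
  rewrite disjoint_sym -setI_eq0 setIDAC.
  have /cards1P[z zE] : #|e :&: e'| == 1%N by rewrite eqn_leq ee' (cardsD1 u) uI.
  by move: uI; rewrite zE inE => /eqP ->; rewrite setDv.
rewrite (joint_prob_recolor _ eE ue) -[X in _ = _ * X](avg_mono_edge e'E); congr (_ * _).
by apply: eq_avg => x; rewrite recolor_mono_out.
Qed.

(** Both hyperedges are monochromatic exactly when their union is, and the union
    has at most [2 * r - 2] vertices. *)
Lemma joint_prob_large e e' : e \in E -> e' \in E -> (1 < #|e :&: e'|)%N ->
  p * p * c%:R <= joint_prob e e'.
Proof.
move=> eE e'E ee'.
have /card_gt0P[u uI] : (0 < #|e :&: e'|)%N by lia.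
have [ue ue'] : u \in e /\ u \in e' by apply/andP; rewrite -in_setI.
have -> : joint_prob e e' = (c ^ #|e :|: e'|.-1)%:R^-1.
  rewrite -(@avg_mono1 R _ _ c_gt0 (e :|: e') u) ?inE ?ue//.
  by apply: eq_avg => x; rewrite (mono_setU _ ue ue') -natrM mulnb.
rewrite /edge_prob -invfM -natrM -expnD.
rewrite ler_pdivrMl ?ltr0n ?expn_gt0 ?c_gt0//.
rewrite ler_pdivlMr ?ltr0n ?expn_gt0 ?c_gt0// -natrM ler_nat -expnS leq_pexp2l//.
by have := cardsUI e e'; rewrite (E_unif eE) (E_unif e'E); lia.
Qed.

Lemma joint_prob_ge e e' : e \in E -> e' \in E -> p * p <= joint_prob e e'.
Proof.
move=> eE e'E; have [ee'|ee'] := leqP #|e :&: e'| 1.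
  by rewrite joint_prob_small.
apply: le_trans (joint_prob_large eE e'E ee'); rewrite ler_peMr ?ler1n//.
by rewrite mulr_ge0 ?ltW ?edge_prob_gt0.
Qed.

Definition overlap_mass : R :=
  \sum_(e in E) \sum_(e' in E | overlaps e e') joint_prob e e'.

Lemma overlap_mass_ge0 : 0 <= overlap_mass.
Proof. by do 2!apply: sumr_ge0 => ? _; exact: joint_prob_ge0. Qed.

Definition mono_count x : nat := \sum_(e in E) mono x e.

(** Recoloring [e] makes [e] monochromatic, so it raises the count by exactly one
    unless [e] was monochromatic before, or some hyperedge through a recolored
    vertex is monochromatic before or after. *)
Lemma mono_count_recolor e u x : e \in E -> u \in e ->
  (mono_count (recolor e u x) != (mono_count x).+1 <=
   mono x e + \sum_(e' in E | (e' != e) && ~~ [disjoint e' & e :\ u])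
     (mono x e' + mono (recolor e u x) e'))%N.
Proof.
move=> eE ue; case: eqVneq => //=; apply: contraR; rewrite -leqNgt leqn0.
rewrite addn_eq0 sum_nat_eq0 => /andP[/eqP xe /forall_inP h].
rewrite /mono_count !(bigD1 e eE)/= xe recolor_mono add0n add1n eqSS; apply/eqP.
apply: eq_bigr => e' /andP[e'E e'e].
have [dis|ndis] := boolP [disjoint e' & e :\ u].
  by rewrite recolor_mono_out.
by have := h e'; rewrite [e' \in E]e'E e'e ndis addn_eq0 => /(_ isT)/andP[/eqP -> /eqP ->].
Qed.

Lemma card_touching e u : e \in E ->
  (\sum_(e' in E | (e' != e) && ~~ [disjoint e' & e :\ u]) 1 <=
   \sum_(v in e :\ u) deg E v)%N.
Proof.
move=> eE; rewrite exchange_big/= big_mkcondr/=; apply: leq_sum => e' e'E.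
case: ifP => // /andP[_]; rewrite -setI_eq0 => /set0Pn[v].
by rewrite inE => /andP[ve' ve]; rewrite (bigD1 v)//= ve'.
Qed.

(** Given that [e] is monochromatic, which has probability [p], the coloring is
    distributed as a recolored one. By [mono_count_recolor] the probability that
    the latter has count [k.+1] differs from that of a count of [k] by at most the
    probability that [e] was already monochromatic or another hyperedge
    interferes. Those overlapping [e]
    contribute through the joint probability, those sharing one vertex with [e]
    contribute [2 * (p * p)] each and are counted by degrees. *)
Lemma stein_edge e k : e \in E ->
  `|avg (fun x => (mono x e)%:R * (mono_count x == k.+1)%:R) -
    p * avg (fun x => (mono_count x == k)%:R)| <=
  p * p + 2 * (\sum_(e' in E | overlaps e e') joint_prob e e') +
  2 * (p * p) *
    (\sum_(u in e) \sum_(v in e :\ u) minn (deg E u) (deg E v))%:R.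
Proof.
move=> eE; have [u ue hub] := exists_hub E (edge_neq0 eE).
have p0 := edge_prob_gt0.
rewrite (avg_mono c_gt0 _ ue) E_unif// -/p -mulrBr -avgB.
rewrite normrM (gtr0_norm p0).
set touch := fun e' => (e' != e) && ~~ [disjoint e' & e :\ u].
apply: (@le_trans _ _ (p * (p + \sum_(e' in E | touch e')
    (p + avg (fun x => (mono (recolor e u x) e')%:R))))).
  rewrite ler_wpM2l ?(ltW p0)//; apply: le_trans (avg_norm _) _.
  have -> : p + \sum_(e' in E | touch e')
      (p + avg (fun x => (mono (recolor e u x) e')%:R)) =
      avg (fun x => (mono x e + \sum_(e' in E | touch e')
         (mono x e' + mono (recolor e u x) e'))%N%:R).
    under [RHS]eq_avg => x do rewrite natrD natr_sum.
    rewrite avgD avg_mono_edge// avg_sum; congr (_ + _); apply: eq_bigr => e'.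
    case/andP => e'E _; under [RHS]eq_avg => x do rewrite natrD.
    by rewrite avgD avg_mono_edge.
  apply: le_avg => x.
  apply: (@le_trans _ _ (mono_count (recolor e u x) != (mono_count x).+1)%:R).
    have [->|_] := eqVneq (mono_count (recolor e u x)) (mono_count x).+1.
      by rewrite eqSS subrr normr0.
    case: (_ == k.+1); case: (_ == k);
      by rewrite ?subrr ?subr0 ?sub0r ?normrN ?normr0 ?normr1.
  by rewrite ler_nat mono_count_recolor.
rewrite mulrDr -addrA lerD2l mulr_sumr.
rewrite (eq_bigr (fun e' => p * p + joint_prob e e')); last first.
  by move=> e' _; rewrite mulrDr (joint_prob_recolor _ eE ue).
apply: (@le_trans _ _ (2 * (\sum_(e' in E | overlaps e e') joint_prob e e') +
    \sum_(e' in E | touch e') 2 * (p * p) * 1)); last first.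
  rewrite lerD2l -mulr_sumr ler_wpM2l ?mulr_ge0 ?(ltW p0)//.
  apply: le_trans (_ : (\sum_(e' in E | touch e') 1)%N%:R <= _).
    by rewrite natr_sum.
  by rewrite ler_nat; exact: leq_trans (card_touching u eE) hub.
rewrite mulr_sumr big_mkcondr/= [X in _ <= _ + X]big_mkcondr/=.
rewrite [X in _ <= X + _]big_mkcondr/= -big_split/=; apply: ler_sum => e' e'E.
have pp0 : 0 <= p * p by rewrite mulr_ge0 ?(ltW p0).
have jge := joint_prob_ge eE e'E.
have j0 := joint_prob_ge0 e e'.
rewrite /touch /overlaps; case: eqVneq => [_|_] /=; first by rewrite addr0.
case: (ltnP 1 #|e :&: e'|) => t1; last rewrite (joint_prob_small eE e'E t1);
  case: ifP => _; lra.
Qed.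

End one_hypergraph.

(** * Mean, variance and the Stein recursion *)

Section bounds.
Context (R : realFieldType) (V : finType) (c : nat) (c_gt0 : (0 < c)%N).
Context (r : nat) (r_ge2 : (2 <= r)%N) (E : {set {set V}}).
Hypothesis E_unif : forall e, e \in E -> #|e| = r.
Local Notation coloring := {ffun V -> 'I_c}.
Local Notation p := (edge_prob R c r).
Local Notation A := (overlap_mass R c E).
Implicit Types (x : coloring) (e : {set V}).

Definition mono_count_pmf k : R := avg (fun x => (mono_count E x == k)%:R).
Local Notation a := mono_count_pmf.

Definition mono_mean : R := #|E|%:R * p.

Lemma mono_meanE : avg (fun x => (mono_count E x)%:R) = mono_mean.
Proof.
under eq_avg => x do rewrite natr_sum.
rewrite avg_sum (eq_bigr (fun=> p)); last by move=> e; exact: avg_mono_edge.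
by rewrite sumr_const /mono_mean mulr_natl.
Qed.

Lemma mono_count_pmf_ge0 k : 0 <= a k.
Proof. by apply: avg_ge0 => x; rewrite ler0n. Qed.

Lemma mono_count_cdfE m :
  avg (fun x => (mono_count E x < m)%:R) = \sum_(k < m) a k.
Proof.
rewrite -avg_sum; apply: eq_avg => x.
have [xm|xm] := ltnP.
  rewrite (bigD1 (Ordinal xm))//= eqxx big1 ?addr0// => i.
  by rewrite -val_eqE/= eq_sym => /negbTE ->.
by rewrite big1// => i _; case: eqP => // xi; have := ltn_ord i; lia.
Qed.

Lemma mono_count_cdf_le1 m : \sum_(k < m) a k <= 1.
Proof.
rewrite -mono_count_cdfE -[leRHS](avg_cst 1 (card_coloring_gt0 V c_gt0)).
by apply: le_avg => x; rewrite lern1 leq_b1.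
Qed.

Lemma mono_count_markov m :
  m%:R * (1 - \sum_(k < m) a k) <= mono_mean.
Proof.
rewrite -mono_count_cdfE -[X in X - _](avg_cst 1 (card_coloring_gt0 V c_gt0)).
rewrite -avgB -avgZ -mono_meanE; apply: le_avg => x.
by case: ltnP => xm; rewrite ?subrr ?mulr0 ?ler0n// subr0 mulr1 ler_nat.
Qed.

(** Sum over the hyperedges of [stein_edge]. When the mean stays bounded and [p]
    and the overlap mass vanish, the right-hand side stays bounded for each fixed
    [s], by a limit that does not depend on [s]; dividing by a large [s] shows
    that the difference on the left vanishes. *)
Lemma stein_bound k s :
  s%:R * `|k.+1%:R * a k.+1 - mono_mean * a k| <=
  (s%:R + s%:R ^+ 2 * r%:R ^+ 2) * (p * mono_mean) +
  (2 * s%:R + s%:R ^+ 2 * r%:R ^+ 2) * A + r%:R ^+ 2 * mono_mean ^+ 2.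
Proof.
have p0 := @edge_prob_gt0 R c c_gt0 r.
set D := (\sum_(e in E) \sum_(u in e) \sum_(v in e :\ u)
  minn (deg E u) (deg E v))%N.
set B := (\sum_(e in E) \sum_(e' in E | overlaps e e') 1)%N.
have stein : `|k.+1%:R * a k.+1 - mono_mean * a k| <=
    p * mono_mean + 2 * A + 2 * (p * p) * D%:R.
  have -> : k.+1%:R * a k.+1 = \sum_(e in E)
      avg (fun x => (mono x e)%:R * (mono_count E x == k.+1)%:R).
    rewrite -avg_sum -avgZ; apply: eq_avg => x; rewrite -mulr_suml -natr_sum.
    by case: eqP => [xk|_]; [rewrite -xk | rewrite !mulr0].
  have -> : mono_mean * a k = \sum_(e in E) p * a k.
    by rewrite sumr_const /mono_mean -mulrA mulr_natl.
  rewrite -sumrB; apply: le_trans (ler_norm_sum _ _ _) _.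
  apply: le_trans (ler_sum _ (fun e eE => stein_edge R c_gt0 r_ge2 E_unif k eE)) _.
  rewrite big_split/= big_split/= sumr_const /D natr_sum -!mulr_sumr.
  by rewrite /mono_mean (mulrCA p) (mulr_natl (p * p) #|E|).
have D_le : 2 * s%:R * D%:R <=
    s%:R ^+ 2 * (r%:R ^+ 2 * (#|E|%:R + B%:R)) + (r%:R * #|E|%:R) ^+ 2 :> R.
  by have := sum_minn_deg E_unif s; rewrite -(ler_nat R) !(natrD, natrM, natrX).
have B_le : p * p * B%:R <= A.
  rewrite natr_sum mulr_sumr; apply: ler_sum => e eE.
  rewrite natr_sum mulr_sumr; apply: ler_sum => e' /andP[e'E _].
  by rewrite mulr1 (joint_prob_ge _ c_gt0 r_ge2 E_unif).
apply: le_trans (ler_wpM2l (ler0n _ s) stein) _.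
have := ler_wpM2l (ltW (mulr_gt0 p0 p0)) D_le.
have := ler_wpM2l (mulr_ge0 (sqr_ge0 (s%:R : R)) (sqr_ge0 (r%:R : R))) B_le.
by rewrite /mono_mean; nra.
Qed.

Section weights.
Context (K : nat) (w : {set V} -> nat).
Hypothesis w_bnd : forall e, e \in E -> (1 <= w e <= K)%N.

Definition wcount x : nat := \sum_(e in E) w e * mono x e.

Definition wmean : R := avg (fun x => (wcount x)%:R).

Definition wvar : R := avg (fun x => ((wcount x)%:R - wmean) ^+ 2).

(** The factor vanishes for weight 1, and for larger weights it dominates both 1
    and the excess weight, so this controls replacing all weights by 1. *)
Definition heavy_mass : R := \sum_(e in E) (w e * (w e).-1)%:R * p.

Lemma heavy_mass_ge0 : 0 <= heavy_mass.
Proof.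
by apply: sumr_ge0 => e _; rewrite mulr_ge0 ?ler0n// ltW ?edge_prob_gt0.
Qed.

Lemma wmeanE : wmean = \sum_(e in E) (w e)%:R * p.
Proof.
rewrite /wmean; under eq_avg => x do rewrite natr_sum.
rewrite avg_sum; apply: eq_bigr => e eE.
under eq_avg => x do rewrite natrM.
by rewrite avgZ (avg_mono_edge _ c_gt0 r_ge2 E_unif).
Qed.

Lemma wvarE : wvar =
  \sum_(e in E) \sum_(e' in E) (w e * w e')%:R * (joint_prob R c e e' - p * p).
Proof.
have -> : wvar = avg (fun x => (wcount x)%:R ^+ 2) - wmean ^+ 2.
  transitivity (avg (fun x : coloring => (wcount x)%:R ^+ 2 +
      (- 2 * wmean * (wcount x)%:R + wmean ^+ 2))).
    by apply: eq_avg => x; ring.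
  rewrite !avgD avgZ -/wmean (avg_cst _ (card_coloring_gt0 V c_gt0)).
  by ring.
have -> : avg (fun x => (wcount x)%:R ^+ 2) =
    \sum_(e in E) \sum_(e' in E) (w e * w e')%:R * joint_prob R c e e'.
  under eq_avg => x do rewrite natr_sum expr2 big_distrlr/=.
  rewrite avg_sum; apply: eq_bigr => e _.
  rewrite avg_sum; apply: eq_bigr => e' _.
  by rewrite -avgZ; apply: eq_avg => x; rewrite !natrM; ring.
rewrite wmeanE expr2 big_distrlr/= -sumrB; apply: eq_bigr => e _.
by rewrite -sumrB; apply: eq_bigr => e' _; rewrite natrM; ring.
Qed.

(** Every covariance is nonnegative, and a hyperedge of weight [w] contributes
    [w ^ 2] times the variance of its indicator, while its mean only counts [w]
    times. So the variance can only be close to the mean if both the overlapping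
    pairs and the hyperedges of weight at least 2 contribute little. *)
Lemma variance_excess : (2 <= c)%N ->
  A / 2 + heavy_mass <= wvar - wmean + K%:R * p * wmean.
Proof.
move=> c2; have p0 := @edge_prob_gt0 R c c_gt0 r.
rewrite wvarE wmeanE mulr_sumr /overlap_mass /heavy_mass mulr_suml.
rewrite -sumrB -!big_split/=; apply: ler_sum => e eE.
rewrite [X in _ <= X - _ + _](bigD1 e eE)/=.
rewrite (joint_prob_diag _ c_gt0 r_ge2 E_unif)//.
have : (\sum_(e' in E | overlaps e e') joint_prob R c e e') / 2 <=
    \sum_(e' in E | e' != e) (w e * w e')%:R * (joint_prob R c e e' - p * p).
  rewrite mulr_suml big_mkcondr [leRHS]big_mkcondr; apply: ler_sum => e' e'E.
  have J0 := joint_prob_ge0 R c e e'.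
  have J_ge : 0 <= joint_prob R c e e' - p * p.
    by rewrite subr_ge0 (joint_prob_ge R c_gt0 r_ge2 E_unif).
  rewrite /overlaps; case: eqVneq => //= _.
  have ww : 1 <= (w e * w e')%:R :> R.
    by rewrite ler1n muln_gt0; move: (w_bnd eE) (w_bnd e'E); lia.
  case: ifPn => t1; last by rewrite mulr_ge0 ?ler0n.
  (* [p * p <= joint / c <= joint / 2], so the covariance is at least half the
     joint probability. *)
  have := joint_prob_large R c_gt0 r_ge2 E_unif eE e'E t1.
  have c2R : 2 <= c%:R :> R by rewrite ler_nat.
  have pp0 : 0 <= p * p by rewrite mulr_ge0 ?(ltW p0).
  have := ler_wpM2l pp0 c2R.
  have := ler_wpM2r J_ge ww.
  lra.
have /andP[w1 wK] := w_bnd eE.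
have -> : (w e * (w e).-1)%:R = (w e)%:R * (w e)%:R - (w e)%:R :> R.
  by rewrite -natrM -natrB ?leq_pmull//; congr _%:R; nia.
rewrite natrM.
have wKR : (w e)%:R <= K%:R :> R by rewrite ler_nat.
have := ler_wpM2r (mulr_ge0 (mulr_ge0 (ltW p0) (ltW p0)) (ler0n R (w e))) wKR.
nra.
Qed.

Lemma wmean_sub : 0 <= wmean - mono_mean <= heavy_mass.
Proof.
have p0 := @edge_prob_gt0 R c c_gt0 r.
have -> : mono_mean = \sum_(e in E) p by rewrite sumr_const /mono_mean mulr_natl.
rewrite wmeanE -sumrB; apply/andP; split.
  apply: sumr_ge0 => e eE; rewrite subr_ge0 ler_peMl ?(ltW p0)// ler1n.
  by have := w_bnd eE; lia.
apply: ler_sum => e eE; rewrite -[X in _ - X]mul1r -mulrBl ler_wpM2r ?(ltW p0)//.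
by have := w_bnd eE => ?; rewrite lerBlDr natr1 ler_nat; nia.
Qed.

Lemma wcount_mono_count : avg (fun x => (wcount x != mono_count E x)%:R) <= heavy_mass.
Proof.
have -> : heavy_mass =
    avg (fun x => (\sum_(e in E) (w e * (w e).-1) * mono x e)%N%:R).
  under eq_avg => x do rewrite natr_sum.
  rewrite avg_sum; apply: eq_bigr => e eE.
  under eq_avg => x do rewrite natrM.
  by rewrite avgZ (avg_mono_edge _ c_gt0 r_ge2 E_unif).
apply: le_avg => x; rewrite ler_nat.
case: eqVneq => //=; apply: contraR; rewrite -leqNgt leqn0 sum_nat_eq0.
move=> /forall_inP h; apply/eqP/eq_bigr => e eE.
by have := h e eE; have := w_bnd eE; case: (mono x e); nia.
Qed.

Lemma wcount_cdf m :
  `|avg (fun x => (wcount x < m)%:R) - \sum_(k < m) a k| <= heavy_mass.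
Proof.
rewrite -mono_count_cdfE -avgB; apply: le_trans (avg_norm _) _.
apply: le_trans wcount_mono_count; apply: le_avg => x.
have [->|_] := eqVneq (wcount x) (mono_count E x); first by rewrite subrr normr0.
case: (wcount x < m)%N; case: (mono_count E x < m)%N;
  by rewrite ?subrr ?subr0 ?sub0r ?normrN ?normr0 ?normr1.
Qed.

End weights.
End bounds.

(** * Limits of the count and the Poisson law *)

From mathcomp Require Import all_classical all_reals all_analysis.
From mathcomp Require Import measurable_realfun.
Import Order.TTheory GRing.Theory Num.Theory.
Import numFieldNormedType.Exports.
Local Open Scope ring_scope.
Local Open Scope classical_set_scope.

Section limits.
Context (R : realType).

(** Choose [s] large in terms of the tolerance; eventually [s * `|u n|] is at
    most [l + 1]. *)
Lemma cvg0_of_scaled_bounds (u : nat -> R) (v : nat -> nat -> R) (l : R) :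
  (forall s n, s%:R * `|u n| <= v s n) ->
  (forall s, v s n @[n --> \oo] --> l) -> u n @[n --> \oo] --> 0.
Proof.
move=> uv vl; apply/cvgr0Pnorm_le => eps eps0.
set s := (Num.truncn ((`|l| + 1) / eps)).+1.
have s_ge : `|l| + 1 <= s%:R * eps.
  by rewrite -ler_pdivrMr// ltW// truncnS_gt.
have /cvgrPdist_le/(_ 1 ltr01) := vl s.
apply: filterS => n; rewrite ler_distl => /andP[vn _].
have s0 : 0 < s%:R :> R by rewrite ltr0n.
rewrite -(ler_pM2l s0); apply: le_trans (uv s n) _; apply: le_trans s_ge.
by have := ler_norm l; lra.
Qed.

Lemma cvg_sum_ord (f : nat -> nat -> R) (l : nat -> R) m :
  (forall k, f n k @[n --> \oo] --> l k) ->
  \sum_(k < m) f n k @[n --> \oo] --> \sum_(k < m) l k.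
Proof.
move=> fl; elim: m => [|m IH].
  by rewrite big_ord0; under eq_cvg do rewrite big_ord0; exact: cvg_cst.
rewrite big_ord_recr/=; under eq_cvg do rewrite big_ord_recr/=.
exact: cvgD.
Qed.

Section recursion.
Context (a : nat -> nat -> R) (mu : nat -> R) (rate : R).
Hypothesis a_ge0 : forall n k, 0 <= a n k.
Hypothesis a_le1 : forall n m, \sum_(k < m) a n k <= 1.
Hypothesis a_markov : forall n m, m%:R * (1 - \sum_(k < m) a n k) <= mu n.
Hypothesis mu_cvg : mu n @[n --> \oo] --> rate.
Hypothesis a_rec : forall k,
  (k.+1%:R * a n k.+1 - mu n * a n k) @[n --> \oo] --> 0.

(* The Poisson weights up to normalization. *)
Let q := exp_coeff rate.

(** Induction on [k]: the recursion with [mu n] replaced by its limit is the one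
    satisfied by [q], and the replacement costs at most [`|mu n - rate|] because
    [a n k] is at most 1. *)
Lemma pmf_ratio_cvg k : (a n k - q k * a n 0) @[n --> \oo] --> 0.
Proof.
elim: k => [|k IH].
  rewrite (_ : (fun n => _) = (fun=> 0)); first exact: cvg_cst.
  by apply/funext => n; rewrite /q /exp_coeff/= expr0 fact0 divr1 mul1r subrr.
have k0 : k.+1%:R != 0 :> R by rewrite pnatr_eq0.
have mu_a : ((mu n - rate) * a n k) @[n --> \oo] --> 0.
  have /cvgr0Pnorm_le mu0 : (mu n - rate) @[n --> \oo] --> 0.
    exact/subr_cvg0.
  apply/cvgr0Pnorm_le => e e0; apply: filterS (mu0 _ e0) => n; apply: le_trans.
  rewrite normrM ler_piMr// ger0_norm//.
  apply: le_trans (a_le1 n k.+1); rewrite big_ord_recr/= lerDr.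
  exact: sumr_ge0.
have -> : (fun n => a n k.+1 - q k.+1 * a n 0) = (fun n =>
    k.+1%:R^-1 * ((k.+1%:R * a n k.+1 - mu n * a n k) +
      (mu n - rate) * a n k + rate * (a n k - q k * a n 0))).
  apply/funext => n; rewrite /q /exp_coeff/= factS natrM exprS.
  have : k`!%:R != 0 :> R by rewrite pnatr_eq0 -lt0n fact_gt0.
  by move=> f0; field; rewrite ?f0 nat1r k0.
rewrite -(mulr0 k.+1%:R^-1); apply: cvgMr.
rewrite -[X in _ --> X]addr0; apply: cvgD.
  by rewrite -[X in _ --> X]addr0; apply: cvgD.
by rewrite -(mulr0 rate); apply: cvgMr.
Qed.

(** The recursion determines the limit up to the factor [a n 0], and Markov's
    inequality prevents mass from escaping to infinity. *)
Lemma pmf0_cvg : a n 0 @[n --> \oo] --> expR (- rate).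
Proof.
suff : (1 - expR rate * a n 0) @[n --> \oo] --> 0.
  move=> h; have -> : (fun n => a n 0) =
      (fun n => expR (- rate) * (1 - (1 - expR rate * a n 0))).
    apply/funext => n; rewrite opprB addrCA subrr addr0 mulrA.
    by rewrite -expRD addNr expR0 mul1r.
  rewrite -[X in _ --> X]mulr1; apply: cvgMr.
  by rewrite -[X in _ --> X]subr0; apply: cvgB => //; exact: cvg_cst.
apply/cvgr0Pnorm_le => eps eps0.
have S_cvg : series q m @[m --> \oo] --> expR rate.
  exact: (is_cvg_series_exp_coeff rate).
have eps3 : 0 < eps / 3 by rewrite divr_gt0.
have [m [m_gt mS]] : exists m, rate + 1 <= m.+1%:R * (eps / 3) /\
    `|expR rate - series q m.+1| <= eps / 3.
  have /cvgrPdist_le/(_ _ eps3) := S_cvg.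
  move=> [N _ hN]; exists (N + Num.truncn ((rate + 1) / (eps / 3)))%N; split.
    rewrite -ler_pdivrMr//; apply: le_trans (ltW (truncnS_gt _)) _.
    by rewrite ler_nat ltnS leq_addl.
  by apply: hN => /=; lia.
have sum_cvg : (\sum_(k < m.+1) a n k - series q m.+1 * a n 0) @[n --> \oo] --> 0.
  under eq_cvg => n do rewrite /series/= big_mkord mulr_suml -sumrB.
  have := @cvg_sum_ord (fun n k => a n k - q k * a n 0) (fun=> 0) m.+1.
  by rewrite [X in _ --> X]big1// => h; apply: h => k; exact: pmf_ratio_cvg.
have /cvgr0Pnorm_le/(_ _ eps3) sum_near := sum_cvg.
have /cvgrPdist_le/(_ 1 ltr01) mu_near := mu_cvg.
near=> n.
have sum_n : `|\sum_(k < m.+1) a n k - series q m.+1 * a n 0| <= eps / 3.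
  by near: n.
have mu_n : mu n <= rate + 1.
  have : `|rate - mu n| <= 1 by near: n.
  by rewrite ler_distlC => /andP[_].
have tail_n : 1 - \sum_(k < m.+1) a n k <= eps / 3.
  have m0 : 0 < m.+1%:R :> R by rewrite ltr0n.
  rewrite -(ler_pM2l m0); apply: le_trans (a_markov n m.+1) _.
  exact: le_trans mu_n m_gt.
have a01 : a n 0 <= 1.
  by apply: le_trans (a_le1 n 1%N); rewrite big_ord_recr/= big_ord0 add0r.
have S_n : `|(expR rate - series q m.+1) * a n 0| <= eps / 3.
  by rewrite normrM (ger0_norm (a_ge0 n 0)); apply: le_trans mS; rewrite ler_piMr.
have := a_le1 n m.+1.
move: sum_n S_n; rewrite !ler_norml => /andP[? ?] /andP[? ?] ?.
by apply/andP; split; lra.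
Unshelve. all: by end_near. Qed.

Lemma pmf_cvg k : a n k @[n --> \oo] --> expR (- rate) * exp_coeff rate k.
Proof.
have -> : (fun n => a n k) = (fun n => (a n k - q k * a n 0) + q k * a n 0).
  by apply/funext => n; rewrite subrK.
rewrite -[X in _ --> X]add0r mulrC; apply: cvgD; first exact: pmf_ratio_cvg.
by apply: cvgMr; exact: pmf0_cvg.
Qed.

End recursion.

End limits.

Section half_line.
Context (R : realType).

(** The number of natural numbers that are at most [x]; the truncation of a
    negative number is 0, whence the case distinction. *)
Definition card_nat_le (x : R) : nat := if 0 <= x then (Num.truncn x).+1 else 0.

Lemma lt_card_nat_le x k : (k < card_nat_le x)%N = (k%:R <= x).
Proof.
rewrite /card_nat_le; case: ifPn => x0; first by rewrite ltnS truncn_ge_nat.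
by apply/esym/negbTE; apply: contraNN x0; exact: le_trans.
Qed.

End half_line.

Section poisson.
Context (R : realType).
Local Open Scope ereal_scope.

(** At rate 0 the exponential coefficients are those of the Dirac mass at 0. *)
Lemma poisson_prob_set1 (rate : R) k : (0 <= rate)%R ->
  poisson_prob rate 0 [set k] = (expR (- rate) * exp_coeff rate k)%:E.
Proof.
rewrite le_eqVlt => /predU1P[<-|rate0]; rewrite /poisson_prob /exp_coeff/=.
  rewrite ltxx oppr0 expR0 mul1r expr0n diracE.
  case: k => [|k]; first by rewrite mem_set//= fact0 divr1.
  by rewrite memNset//= mul0r.
rewrite rate0 esum_set1 ?lee_fin ?poisson_pmf_ge0// /poisson_pmf rate0.
by rewrite mulrC.
Qed.

Lemma poisson_prob_II (rate : R) m : (0 <= rate)%R ->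
  poisson_prob rate 0 `I_m =
  (\sum_(k < m) expR (- rate) * exp_coeff rate k)%:E.
Proof.
move=> rate0; elim: m => [|m IH]; first by rewrite II0 measure0 big_ord0.
rewrite IIS big_ord_recr/= EFinD -IH -poisson_prob_set1//.
apply: measureU => //.
by apply/seteqP; split => // k [/= km keq]; rewrite keq ltnn in km.
Qed.

Lemma poisson_law_itv (rate x : R) : (0 <= rate)%R ->
  poisson_law rate `]-oo, x]%classic =
  (\sum_(k < card_nat_le x) expR (- rate) * exp_coeff rate k)%:E.
Proof.
move=> rate0; rewrite -poisson_prob_II//.
rewrite /poisson_law /distribution /pushforward; congr (poisson_prob _ _ _).
by apply/seteqP; split => k /=; rewrite in_itv/= lt_card_nat_le.
Qed.

End poisson.

(** * From random variables to uniform colorings *)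

Section transfer.
Context d (T : measurableType d) (R : realType) (P : probability T R).
Context (V : finType) (c : nat) (c_gt0 : (0 < c)%N) (X : V -> {RV P >-> nat}).
Hypothesis X_unif : uniform_coloring c X.
Local Notation coloring := {ffun V -> 'I_c}.
Local Open Scope ereal_scope.

Let atom (x : coloring) : set T := \bigcap_v (X v @^-1` [set (x v).+1]).

Let measurable_atom x : measurable (atom x).
Proof.
apply: fin_bigcap_measurable; first exact: finite_finset.
by move=> v _; exact: measurable_funPTI.
Qed.

Let prob_atom x : P (atom x) = (#|{: coloring}|%:R^-1)%:E.
Proof.
rewrite /atom; have [-> // unif] := X_unif.
rewrite (eq_bigr (fun=> (c%:R^-1)%:E)) => [|v _]; last first.
  by rewrite unif//= ltn_ord.
by rewrite prodEFin prodr_const card_ffun card_ord natrX exprVn.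
Qed.

Let atoms := \big[setU/set0]_(x : coloring) atom x.

Let trivIset_atom (D : set coloring) : trivIset D atom.
Proof.
move=> x y _ _ [t [xt yt]]; apply/ffunP => v; apply/val_inj/succn_inj.
by rewrite -(xt v)// -(yt v).
Qed.

Let integral_atoms (f : T -> \bar R) : measurable_fun setT f ->
  (forall t, 0 <= f t) -> \int[P]_(t in atoms) f t =
  \sum_(x : coloring) \int[P]_(t in atom x) f t.
Proof.
move=> mf f0; apply: ge0_integral_bigsetU => //.
- exact: index_enum_uniq.
- exact: measurable_funTS.
Qed.

Let measurable_atoms : measurable atoms.
Proof. exact: bigsetU_measurable. Qed.

Let prob_atoms : P atoms = 1.
Proof.
rewrite -[P atoms]mul1e -integral_cst// integral_atoms//.
rewrite (eq_bigr (fun=> (#|{: coloring}|%:R^-1)%:E)) => [|x _]; last first.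
  by rewrite integral_cst// mul1e; exact: prob_atom.
rewrite sumEFin sumr_const -[(_ *+ _)%R]mulr_natr mulVf//.
by rewrite pnatr_eq0 -lt0n card_coloring_gt0.
Qed.

(** Up to a null set the sample space is the disjoint union of the events that
    the coloring equals a given element of the finite space of colorings, all
    of the same probability. *)
Lemma integral_coloring (G : (V -> nat) -> R) (f : T -> R) :
  measurable_fun setT f -> (forall t, 0 <= f t)%R ->
  (forall t, f t = G (fun v => X v t)) ->
  \int[P]_t (f t)%:E = (avg (fun x : coloring => G (fun v => (x v).+1)))%:E.
Proof.
move=> mf f0 fG.
rewrite (@ge0_negligible_integral _ _ _ _ _ (~` atoms))//; first last.
- by rewrite [LHS]probability_setC// prob_atoms subee.
- by move=> t _; rewrite lee_fin.
- exact/measurable_EFinP.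
- exact: measurableC.
rewrite setDE setCK setTI integral_atoms//; last exact/measurable_EFinP.
rewrite /avg mulr_suml -sumEFin; apply: eq_bigr => x _.
rewrite (eq_integral (cst (G (fun v => (x v).+1))%:E)).
  by rewrite integral_cst// EFinM; congr (_ * _); exact: prob_atom.
move=> t; rewrite inE => xt; rewrite /= fG; congr (G _)%:E.
by apply/funext => v; rewrite (xt v).
Qed.

End transfer.

(** Colors range over all natural numbers here: the random colors lie in the
    range from 1 to [c] only almost surely. *)
Definition nat_wcount (R : realType) (V : finType) (E : {set {set V}})
    (w : {set V} -> nat) (f : V -> nat) : R :=
  (\sum_(e in E) w e * mono f e)%N%:R.

Lemma nat_wcountS (R : realType) (V : finType) (c : nat) (E : {set {set V}})
    (w : {set V} -> nat) (x : {ffun V -> 'I_c}) :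
  nat_wcount R E w (fun v => (x v).+1) = (wcount E w x)%:R.
Proof. by []. Qed.

Section weighted_count_law.
Context d (T : measurableType d) (R : realType) (P : probability T R).
Context (r : nat) (H : hypergraph r) (w : {set H} -> nat).
Context (X : H -> {RV P >-> nat}) (c : nat) (c_gt0 : (0 < c)%N).
Hypothesis X_unif : uniform_coloring c X.
Local Notation E := (hyperedges H).

Lemma weighted_countE t :
  weighted_count w X t = nat_wcount R E w (fun v => X v t).
Proof.
rewrite /nat_wcount natr_sum; apply: eq_bigr => e _; rewrite natrM; congr (_ * _).
rewrite indicE; congr (nat_of_bool _)%:R; apply/idP/monoP; first by rewrite inE.
by move=> h; rewrite inE => u v; exact: h.
Qed.

Lemma expectation_weighted_count :
  'E_P[weighted_count w X]%E = (wmean R c E w)%:E.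
Proof.
rewrite unlock (integral_coloring c_gt0 X_unif (G := nat_wcount R E w))//.
- by move=> t; rewrite weighted_countE ler0n.
- exact: weighted_countE.
Qed.

Lemma variance_weighted_count :
  'V_P[weighted_count w X]%E = (wvar R c E w)%:E.
Proof.
rewrite /variance unlock expectation_weighted_count/= unlock.
rewrite (integral_coloring c_gt0 X_unif
  (G := fun f => (nat_wcount R E w f - wmean R c E w) ^+ 2)).
- by congr EFin; apply: eq_avg => x; rewrite nat_wcountS.
- by apply: measurable_funM; apply: measurable_funB.
- by move=> t; rewrite -expr2 sqr_ge0.
- by move=> t; rewrite -weighted_countE.
Qed.

Lemma cdf_weighted_count x :
  cdf (weighted_count w X : {RV P >-> R}) x =
  (avg (fun y : {ffun H -> 'I_c} => (wcount E w y < card_nat_le x)%N%:R))%:E.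
Proof.
have -> : cdf (weighted_count w X : {RV P >-> R}) x =
    P (weighted_count w X @^-1` `]-oo, x]%classic) by [].
rewrite -expectation_indic; last exact: measurable_funPTI.
rewrite unlock (integral_coloring c_gt0 X_unif
  (G := fun f => (nat_wcount R E w f <= x)%R%:R))//.
- by congr EFin; apply: eq_avg => y; rewrite nat_wcountS lt_card_nat_le.
- by apply: measurable_indic; exact: measurable_funPTI.
- move=> t; rewrite indicE; congr (nat_of_bool _)%:R; rewrite -weighted_countE.
  by apply/idP/idP; rewrite inE/= in_itv.
Qed.

End weighted_count_law.

(** * Poisson convergence *)

Local Open Scope classical_set_scope.
Local Open Scope ring_scope.
Local Open Scope ereal_scope.

Theorem mainTheorem11 (R : realType) (r K : nat) (hr : (2 <= r)%N)
  (hK : (1 <= K)%N)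
  (H : nat -> hypergraph r)
  (w : forall n, {set H n} -> nat)
  (hw : forall n (e : {set H n}),
     e \in hyperedges (H n) -> (1 <= w n e <= K)%N)
  (c : nat -> nat) (c_gt0 : forall n, (0 < c n)%N)
  (hc : c n @[n --> \oo] --> \oo)
  (d : nat -> measure_display) (Omega : forall n, measurableType (d n))
  (P : forall n, probability (Omega n) R)
  (X : forall n, H n -> {RV (P n) >-> nat})
  (hX : forall n, uniform_coloring (c n) (X n))
  (lambda : R) (hlambda : (0 <= lambda)%R)
  (hE : 'E_(P n)[weighted_count (w n) (X n)] @[n --> \oo] --> lambda%:E)
  (hV : 'V_(P n)[weighted_count (w n) (X n)] @[n --> \oo] --> lambda%:E) :
  cvg_in_distribution (P := P) (fun n => weighted_count (w n) (X n))
    (poisson_law lambda).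
Proof.
pose E n := hyperedges (H n).
have E_unif n e : e \in E n -> #|e| = r by exact: card_hyperedge.
pose p n : R := edge_prob R (c n) r.
pose overlap n : R := overlap_mass R (c n) (E n).
pose mu n : R := mono_mean R (c n) r (E n).
pose heavy n : R := heavy_mass R (c n) r (E n) (w n).
pose mean n : R := wmean R (c n) (E n) (w n).
pose var n : R := wvar R (c n) (E n) (w n).
pose a n (k : nat) : R := mono_count_pmf R (c n) (E n) k.
have mean_cvg : mean n @[n --> \oo] --> lambda.
  have -> : mean = fine \o (fun n => 'E_(P n)[weighted_count (w n) (X n)]).
    by apply/funext => n /=; rewrite (expectation_weighted_count _ (c_gt0 n)).
  exact: fine_cvg.
have var_cvg : var n @[n --> \oo] --> lambda.
  have -> : var = fine \o (fun n => 'V_(P n)[weighted_count (w n) (X n)]).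
    by apply/funext => n /=; rewrite (variance_weighted_count _ (c_gt0 n)).
  exact: fine_cvg.
have p_cvg : p n @[n --> \oo] --> 0%R.
  have cV_cvg : ((c n)%:R^-1 : R)%R @[n --> \oo] --> 0%R.
    apply/gtr0_cvgV0; last exact/cvgrnyP.
    by near=> n; rewrite ltr0n.
  apply: squeeze_cvgr (cvg_cst 0%R) cV_cvg.
  near=> n; rewrite ltW ?edge_prob_gt0//= /p /edge_prob lef_pV2 ?posrE ?ltr0n//.
    by rewrite ler_nat -[leqLHS]expn1 leq_pexp2l//; lia.
  by rewrite expn_gt0 c_gt0.
have excess_cvg :
    (var n - mean n + K%:R * p n * mean n)%R @[n --> \oo] --> 0%R.
  have -> : 0%R = (lambda - lambda + K%:R * 0 * lambda)%R by ring.
  apply: cvgD; first exact: cvgB.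
  by apply: cvgM => //; apply: cvgMr.
(* [variance_excess] applies once there are at least two colors. *)
have excess_near : \forall n \near \oo,
    (overlap n / 2 + heavy n <= var n - mean n + K%:R * p n * mean n)%R.
  have /cvgnyPge/(_ 2%N) := hc; apply: filterS => n c2.
  exact: (variance_excess R (c_gt0 n) hr (E_unif n) (hw n) c2).
have heavy_ge0 n : (0 <= heavy n)%R by exact: heavy_mass_ge0.
have overlap_ge0 n : (0 <= overlap n)%R by exact: overlap_mass_ge0.
have heavy_cvg : heavy n @[n --> \oo] --> 0%R.
  apply: squeeze_cvgr (cvg_cst 0%R) excess_cvg.
  apply: filterS excess_near => n; rewrite heavy_ge0/=.
  by have := overlap_ge0 n; lra.
have overlap_cvg : overlap n @[n --> \oo] --> 0%R.
  have excess2_cvg :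
      (2 * (var n - mean n + K%:R * p n * mean n))%R @[n --> \oo] --> 0%R.
    by rewrite -[0%R in X in _ --> X](mulr0 2%R); apply: cvgMr.
  apply: squeeze_cvgr (cvg_cst 0%R) excess2_cvg.
  apply: filterS excess_near => n; rewrite overlap_ge0/=.
  by have := heavy_ge0 n; lra.
have mu_cvg : mu n @[n --> \oo] --> lambda.
  have lower_cvg : (mean n - heavy n)%R @[n --> \oo] --> lambda.
    by rewrite -[X in _ --> X]subr0; apply: cvgB.
  apply: squeeze_cvgr lower_cvg mean_cvg.
  near=> n.
  have := @wmean_sub R (H n) (c n) (c_gt0 n) r hr (E n) (E_unif n) K (w n) (hw n).
  by rewrite -/(mean n) -/(mu n) -/(heavy n); lra.
have a_rec k : (k.+1%:R * a n k.+1 - mu n * a n k)%R @[n --> \oo] --> 0%R.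
  apply: (@cvg0_of_scaled_bounds _ _ (fun s n =>
    (s%:R + s%:R ^+ 2 * r%:R ^+ 2) * (p n * mu n) +
    (2 * s%:R + s%:R ^+ 2 * r%:R ^+ 2) * overlap n +
    r%:R ^+ 2 * mu n ^+ 2)%R (r%:R ^+ 2 * lambda ^+ 2)%R).
    by move=> s n; exact: (stein_bound R (c_gt0 n) hr (E_unif n)).
  move=> s.
  have -> : (r%:R ^+ 2 * lambda ^+ 2 =
    (s%:R + s%:R ^+ 2 * r%:R ^+ 2) * (0 * lambda) +
    (2 * s%:R + s%:R ^+ 2 * r%:R ^+ 2) * 0 +
    r%:R ^+ 2 * lambda ^+ 2)%R by ring.
  apply: cvgD; first apply: cvgD.
  - by apply: cvgMr; apply: cvgM.
  - exact: cvgMr.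
  - by apply: cvgMr; rewrite !expr2; apply: cvgM.
have a_ge0 n k : (0 <= a n k)%R by exact: mono_count_pmf_ge0.
have a_le1 n m : (\sum_(k < m) a n k <= 1)%R.
  exact: mono_count_cdf_le1.
have a_markov n m : (m%:R * (1 - \sum_(k < m) a n k) <= mu n)%R.
  exact: (mono_count_markov R (c_gt0 n) hr (E_unif n)).
have a_cvg k : a n k @[n --> \oo] --> (expR (- lambda) * exp_coeff lambda k)%R.
  exact: (pmf_cvg a_ge0 a_le1 a_markov mu_cvg a_rec).
move=> x _; rewrite poisson_law_itv//.
under eq_cvg do rewrite (cdf_weighted_count _ (c_gt0 _) (hX _)).
apply: cvg_EFin; first exact: nearW.
set m := card_nat_le x.
have sum_cvg := cvg_sum_ord (m := m) a_cvg.
have diff_cvg : (avg (fun y : {ffun H n -> 'I_(c n)} =>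
    (wcount (E n) (w n) y < m)%N%:R) - \sum_(k < m) a n k)%R
    @[n --> \oo] --> 0%R.
  move/cvgr0Pnorm_le: heavy_cvg => heavy_near.
  apply/cvgr0Pnorm_le => e /heavy_near; apply: filterS => n.
  rewrite ger0_norm//; apply: le_trans.
  exact: (wcount_cdf R (c_gt0 n) hr (E_unif n) (hw n)).
have := cvgD diff_cvg sum_cvg; rewrite add0r.
by under eq_cvg do rewrite subrK; move=> cdf_cvg; exact: cdf_cvg.
Unshelve. all: by end_near. Qed.
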